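(* For every integer $n>24$, the generalized Petersen graph $GP(n,4)$ is not $\ell$-distance-balanced for any integer $\ell$ with $1\le \ell<{\rm diam}(GP(n,4))$. Moreover, $24$ is the smallest integer with this property, i.e., $24$ is the smallest integer $N$ such that for every $n>N$ the graph $GP(n,4)$ is not $\ell$-distance-balanced for any $1\le \ell<{\rm diam}(GP(n,4))$.
   Context: For a connected graph $G$ and $x,y\in V(G)$, $d_G(x,y)$ denotes the distance and ${\rm diam}(G)$ the diameter. Let $W_{xy}=\{w\in V(G): d_G(w,x)<d_G(w,y)\}$. For an integer $\ell$ with $1\le \ell\le {\rm diam}(G)$, $G$ is called $\ell$-distance-balanced if $|W_{xy}|=|W_{yx}|$ for every pair $x,y\in V(G)$ with $d_G(x,y)=\ell$. For integers $n\ge 3$ and $1\le k<n/2$, the generalized Petersen graph $GP(n,k)$ has vertex set $\{u_i: i\in\mathbb{Z}_n\}\cup\{v_i: i\in\mathbb{Z}_n\}$ and edge set $\{u_iu_{i+1}: i\in\mathbb{Z}_n\}\cup\{v_iv_{i+k}: i\in\mathbb{Z}_n\}\cup\{u_iv_i: i\in\mathbb{Z}_n\}$. *)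

(* Defs.v *)
From mathcomp Require Import all_boot.
Set Implicit Arguments. Unset Strict Implicit. Unset Printing Implicit Defensive.

Section Graphs.
Variables (T : finType) (e : rel T).

Definition walk_of_len (k : nat) (x y : T) : bool :=
  [exists p : k.-tuple T, path e x p && (last x p == y)].

(* graph distance: least length of a walk from x to y
   (equals #|T| when y is unreachable; irrelevant for connected graphs) *)
Definition gdist (x y : T) : nat :=
  find (fun k => walk_of_len k x y) (iota 0 #|T|).

Definition gdiam : nat := \max_(x : T) \max_(y : T) gdist x y.

Definition Wset (x y : T) : {set T} := [set w | gdist w x < gdist w y].

Definition dist_balanced (l : nat) : Prop :=
  forall x y : T, gdist x y = l -> #|Wset x y| = #|Wset y x|.

End Graphs.

(* Generalized Petersen graph GP(n,k): vertex (false, i) is u_i, (true, i) is v_i *)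
Definition GPvert (n : nat) := (bool * 'I_n)%type.

Definition GPadj (n k : nat) : rel (GPvert n) := fun x y =>
  match x.1, y.1 with
  | false, false => (val y.2 == (val x.2 + 1) %% n) || (val x.2 == (val y.2 + 1) %% n)
  | true, true => (val y.2 == (val x.2 + k) %% n) || (val x.2 == (val y.2 + k) %% n)
  | _, _ => x.2 == y.2
  end.

Arguments GPadj n k : clear implicits.

(* GP(n,4) (defined for n >= 9) is not l-distance-balanced for every 1 <= l < diam,
   for every n > N *)
Definition GP4_property (N : nat) : Prop :=
  forall n : nat, N < n -> 8 < n ->
    forall l : nat, 1 <= l -> l < gdiam (GPadj n 4) ->
      ~ dist_balanced (GPadj n 4) l.

(* Main.v *)
Require Import Defs.
From mathcomp Require Import all_boot.
From mathcomp Require Import zify.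

(** Let f(j) be the distance from 0 to j in the Cayley graph of Z_n with generators
    1 and 4.  Every walk between u_0 and v_j uses a spoke, so d(u_0, v_j) = f(j) + 1,
    while d(u_0, u_i) and d(v_0, v_i) equal f(i) + 2 except when the outer (resp.
    inner) rim is shorter; for d(u_0, u_i) this happens only if |i| <= 3.

    Take x = u_0 and y = v_j with f(j) + 1 = l; such a j exists since the diameter is
    at most max f + 2 and f changes by at most 1 along the rim.  The reflection
    i -> j - i pairs v_(j-i) with u_i, and writing c = f(j-i) + 1 the pair contributes
    [d(u_0,u_i) < c] + [c < d(v_0,v_i)] to |W_xy| and
    [c < d(u_0,u_i)] + [d(v_0,v_i) < c] to |W_yx|.
    For 4 <= i <= n - 4 one has d(v_0,v_i) <= d(u_0,u_i), so the first contribution is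
    at most the second.  If f(j) >= 6 this persists for all i and is strict at
    i = 4 floor(f(j)/2), the point where f(i) and f(j-i) differ by at most one; hence
    |W_xy| < |W_yx|.  If f(j) <= 5 and n >= 84, suitable values of j are settled by the
    indices near 0, where nothing depends on n; the remaining n are a finite check, and
    GP(24,4) turns out to be 1-distance-balanced. *)

(** * Graph distance from a potential *)

Lemma find_iota (P : pred nat) (n k : nat) :
  k < n -> P k -> (forall i, P i -> k <= i) -> find P (iota 0 n) = k.
Proof.
move=> kn Pk mink.
have hasP : has P (iota 0 n) by apply/hasP; exists k; rewrite ?mem_iota.
have findn : find P (iota 0 n) < n by rewrite -[X in _ < X](size_iota 0) -has_find.
apply/eqP; rewrite eqn_leq; apply/andP; split.
  rewrite leqNgt; apply/negP => /(before_find 0).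
  by rewrite nth_iota // Pk.
by have /mink := nth_find 0 hasP; rewrite nth_iota.
Qed.

(* A potential that is 1-Lipschitz along edges and can always be decreased is the
   distance from its zero. *)
Section Distance.
Variables (T : finType) (e : rel T) (x : T) (delta : T -> nat).
Hypothesis delta0 : delta x = 0.
Hypothesis delta_edge : forall y z, e y z -> delta z <= (delta y).+1.
Hypothesis delta_descent :
  forall y, y != x -> exists2 z, e z y & delta z < delta y.

Lemma leq_delta_path (p : seq T) : path e x p -> delta (last x p) <= size p.
Proof.
elim/last_ind: p => [|p y IH]; first by rewrite /= delta0.
rewrite rcons_path last_rcons size_rcons => /andP[/IH le_p /delta_edge].
by move/leq_trans; apply.
Qed.

Lemma delta_path (y : T) :
  exists p : seq T, [/\ path e x p, last x p = y & size p = delta y].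
Proof.
move: {2}(delta y) (leqnn (delta y)) => m.
elim: m y => [|m IH] y le_ym; have [->|/delta_descent[z zy ltzy]] := eqVneq y x;
  try by exists [::]; rewrite delta0.
  by move: (leq_trans ltzy le_ym).
have [p [xp pz sp]] := IH z (leq_trans ltzy le_ym).
exists (rcons p y); rewrite rcons_path last_rcons size_rcons xp pz sp zy.
split=> //; apply/eqP; rewrite eqn_leq ltzy.
exact: delta_edge.
Qed.

Lemma gdist_potential (y : T) : gdist e x y = delta y.
Proof.
have [p [xp py sp]] := delta_path y.
apply: find_iota.
(* Shortening the walk to a simple path gives [delta y < #|T|], the range that [gdist] searches. *)
- rewrite -py; case/shortenP: xp => q xq uq _.
  rewrite (leq_ltn_trans (leq_delta_path _ xq)) //.
  by rewrite -[(size q).+1]/(size (x :: q)) -(card_uniqP uq) max_card.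
- apply/existsP; exists (tcast sp (in_tuple p)).
  by rewrite val_tcast xp /= py.
- move=> i /existsP[q /andP[/leq_delta_path]].
  by rewrite size_tuple => h /eqP <-.
Qed.

End Distance.

(** * Distances in GP(n,4) *)

(* The word length of m in Z for the generators 1 and 4: the residue 3 costs 2
   because 3 = 4 - 1. *)
Definition rad (m : nat) : nat := m %/ 4 + minn (m %% 4) 2.

(* The distance in GP(Z,4) between vertices of types s and t (false for u, true for v)
   whose indices differ by m; for s = t = true the last summand makes it m / 4 when
   4 divides m, and rad m + 2 otherwise. *)
Definition profile (s t : bool) (m : nat) : nat :=
  match s, t with
  | false, false => minn m (rad m + 2)
  | true, true => rad m + minn (m %% 4) 1 * 2
  | _, _ => rad m + 1
  end.

Definition gap (a b : nat) : nat := (a - b) + (b - a).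

(* Folding modulo n: only the representatives o and o - n of the offset matter. *)
Definition cyc (n : nat) (h : nat -> nat) (o : nat) : nat := minn (h o) (h (n - o)).

Lemma cyc_sub n h o : o <= n -> cyc n h (n - o) = cyc n h o.
Proof. by move=> on; rewrite /cyc subKn // minnC. Qed.

Lemma cyc_short n h o : h o <= h (n - o) -> cyc n h o = h o.
Proof. by move/minn_idPl. Qed.

Definition near (x y : nat) : bool := (x <= y.+1) && (y <= x.+1).

Lemma near_cyc_add n h k o : (forall m, near (h m) (h (m + k))) -> o + k <= n ->
  near (cyc n h o) (cyc n h (o + k)).
Proof.
move=> hk okn; move: (hk o) (hk (n - (o + k))).
have -> : n - (o + k) + k = n - o by lia.
rewrite /cyc /near; lia.
Qed.

(** A step of length [k] over the base vertex joins offsets [o] and [k - o]; the second hypothesis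
    makes the direct representative minimal for both. *)
Lemma near_cyc_sub n h k o : (forall m, m <= k -> near (h m) (h (k - m))) ->
  (forall m i, i <= k -> n - k <= m -> h i <= h m) -> o <= k -> k <= n ->
  near (cyc n h o) (cyc n h (k - o)).
Proof.
move=> hk hmax ok kn; have := hk o ok.
have cycE i : i <= k -> cyc n h i = h i.
  by move=> ik; apply: cyc_short; apply: hmax => //; lia.
by rewrite !cycE //; lia.
Qed.

Lemma near_profile_add s t m :
  near (profile s t m) (profile s t (m + (if t then 4 else 1))).
Proof. by case: s; case: t; rewrite /near /profile /rad; lia. Qed.

Lemma near_profile_sub s t m : m <= (if t then 4 else 1) ->
  near (profile s t m) (profile s t ((if t then 4 else 1) - m)).
Proof. by case: s; case: t; move: m => [|[|[|[|[|m]]]]]. Qed.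

(** For [n >= 24] an offset at most 4 has complement at least 20; the profile is at most 4 on the
    former and at least 5 on the latter. *)
Lemma profile_far s t i m : i <= 4 -> 20 <= m -> profile s t i <= profile s t m.
Proof.
move=> i4 m20; have h : 5 <= profile s t m.
  by case: s; case: t; rewrite /profile /rad; lia.
by apply: leq_trans h; case: s; case: t; move: i i4 => [|[|[|[|[|i]]]]].
Qed.

Definition step (n k b c : nat) : bool := (c == (b + k) %% n) || (b == (c + k) %% n).

Lemma add_mod n b k : b < n -> k <= n ->
  (b + k) %% n = if b + k < n then b + k else b + k - n.
Proof.
move=> bn kn; case: ltnP => h; first by rewrite modn_small.
have -> : (b + k) %% n = (b + k - n) %% n by rewrite -{1}(subnK h) modnDr.
by rewrite modn_small //; lia.
Qed.

(** The step moves away from [a], toward it or over it; wrapping past [n] replaces an offset by its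
    complement. *)
Lemma step_gap n k a b c : k <= n -> a < n -> b < n -> c = (b + k) %% n ->
  [\/ gap a c = gap a b + k, gap a b = gap a c + k,
      gap a b <= k /\ (gap a c = k - gap a b \/ gap a c = n - (k - gap a b)) |
      (gap a b + k <= n /\ gap a c = n - (gap a b + k)) \/
      (gap a c <= k /\ gap a b = n - (k - gap a c))].
Proof.
move=> kn an bn; rewrite add_mod // /gap; case: ltnP => h ->.
  case: (leqP a b) => ab; first by constructor 1; lia.
  case: (leqP (b + k) a) => abk; first by constructor 2; lia.
  by constructor 3; lia.
case: (leqP b a) => ab; first by constructor 3; lia.
by constructor 4; lia.
Qed.

Lemma step_cyc_near s t n k a b c : k = (if t then 4 else 1) ->
  24 <= n -> a < n -> b < n -> c = (b + k) %% n ->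
  near (cyc n (profile s t) (gap a b)) (cyc n (profile s t) (gap a c)).
Proof.
move=> kE n24 an bn cE.
have k4 : k <= 4 by rewrite kE; case: (t).
have kn : k <= n by lia.
have cn : c < n by rewrite cE ltn_mod; lia.
have gapn x : x < n -> gap a x <= n by rewrite /gap; lia.
have [bo co] := (gapn b bn, gapn c cn).
have nearC x y : near x y = near y x by rewrite /near andbC.
have hadd o : o + k <= n ->
    near (cyc n (profile s t) o) (cyc n (profile s t) (o + k)).
  by apply: near_cyc_add => m; rewrite kE near_profile_add.
have hsub o : o <= k -> near (cyc n (profile s t) o) (cyc n (profile s t) (k - o)).
  move=> ok; apply: near_cyc_sub => //.
    by move=> m; rewrite kE; apply: near_profile_sub.
  by move=> m i ik mn; apply: profile_far; lia.
case: (step_gap n k a b c kn an bn cE)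
  => [cb|bc|[le [cb|cb]]|[[le cb]|[le bc]]].
- by rewrite cb hadd // -cb.
- by rewrite bc nearC hadd // -bc.
- by rewrite cb hsub.
- by rewrite cb cyc_sub; [rewrite hsub | lia].
- by rewrite cb cyc_sub // hadd.
- by rewrite bc nearC cyc_sub; [rewrite hsub | lia].
Qed.

(** For [a], [b] below [n] and [m <= n]: [b - a] is [m] modulo [n] up to sign, the sign being
    invisible to [cyc]. *)
Definition at_gap (n a b m : nat) : bool := (gap a b == m) || (gap a b == n - m).

Lemma cyc_at_gap n h a b m : m <= n -> at_gap n a b m ->
  cyc n h (gap a b) = cyc n h m.
Proof. by move=> mn /orP[/eqP->|/eqP->] //; rewrite cyc_sub. Qed.

Lemma step_toward n k a b m : a < n -> b < n -> k <= m -> m <= n -> at_gap n a b m ->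
  exists2 c, c < n & step n k b c /\ at_gap n a c (m - k).
Proof.
move=> an bn km mn; rewrite /at_gap /step /gap => bm.
have kn := leq_trans km mn.
have [h|h] : (b = a + m \/ b + n = a + m) \/ (a = b + m \/ a + n = b + m) by lia.
- exists (if b < k then b + n - k else b - k); first by case: ifP; lia.
  split; last by case: ifP; lia.
  apply/orP; right; rewrite add_mod //; last by case: ifP; lia.
  by case: (ltnP b k) => ?; case: ifP; lia.
- exists (if b + k < n then b + k else b + k - n); first by case: ifP; lia.
  split; last by case: ifP; lia.
  by rewrite add_mod // eqxx.
Qed.

Lemma step_away n k a b m : a < n -> b < n -> m + k <= n -> at_gap n a b m ->
  exists2 c, c < n & step n k b c /\ at_gap n a c (m + k).
Proof.
move=> an bn mkn bm.
have bm' : at_gap n a b (n - m) by move: bm; rewrite /at_gap; lia.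
have [||c cn [bc ac]] := step_toward n k a b (n - m) an bn _ _ bm'; try lia.
by exists c => //; split=> //; move: ac; rewrite /at_gap; lia.
Qed.

Lemma step_across n k a b m : a < n -> b < n -> m <= k -> k <= n -> at_gap n a b m ->
  exists2 c, c < n & step n k b c /\ at_gap n a c (k - m).
Proof.
move=> an bn mk kn; rewrite /at_gap /step /gap => bm.
have [h|h] : (b = a + m \/ b + n = a + m) \/ (a = b + m \/ a + n = b + m) by lia.
- exists (if b < k then b + n - k else b - k); first by case: ifP; lia.
  split; last by case: ifP; lia.
  apply/orP; right; rewrite add_mod //; last by case: ifP; lia.
  by case: (ltnP b k) => ?; case: ifP; lia.
- exists (if b + k < n then b + k else b + k - n); first by case: ifP; lia.
  split; last by case: ifP; lia.
  by rewrite add_mod // eqxx.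
Qed.

Lemma profile_spoke s m : near (profile s false m) (profile s true m).
Proof. by rewrite /near /profile /rad; case: s; lia. Qed.

(** The cases are the possible last edges of a geodesic. The outer step to [m.+1] serves residue 3,
    where [rad] uses 3 = 4 - 1; the inner step to [4 - m] serves [m = 3]. *)
Lemma profile_descent s t m : (s != t) || (0 < m) ->
  [\/ profile s (~~ t) m < profile s t m,
      t = false /\ 0 < m /\ profile s t m.-1 < profile s t m,
      t = false /\ 0 < m /\ profile s t m.+1 < profile s t m |
      t = true /\ ((4 <= m /\ profile s t (m - 4) < profile s t m) \/
                   (m <= 4 /\ profile s t (4 - m) < profile s t m))].
Proof.
case: t; case: s => /= h; rewrite /profile.
- case: (leqP 4 m) => m4; first by constructor 4; split=> //; left; rewrite /rad; lia.
  by constructor 1; rewrite /rad; lia.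
- case: (leqP 4 m) => m4; first by constructor 4; split=> //; left; rewrite /rad; lia.
  case: (leqP m 2) => m2; first by constructor 1; rewrite /rad; lia.
  by constructor 4; split=> //; right; rewrite /rad; lia.
- case m4 : (m %% 4 == 0); first by constructor 1; rewrite /rad; lia.
  case m3 : (m %% 4 == 3); first by constructor 3; rewrite /rad; lia.
  by constructor 2; rewrite /rad; lia.
- case: (leqP m (rad m + 1)) => hm; last by constructor 1; rewrite /rad in hm *; lia.
  by constructor 2; rewrite /rad in hm *; lia.
Qed.

Lemma GPadj_sym n k : symmetric (GPadj n k).
Proof.
by case=> [[] a] [[] b]; rewrite /GPadj /=; first [exact: orbC | exact: eq_sym].
Qed.

Lemma GPadj_step n (t : bool) (b c : 'I_n) :
  GPadj n 4 (t, b) (t, c) = step n (if t then 4 else 1) b c.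
Proof. by case: t. Qed.

Lemma GPadj_spoke n (t : bool) (b : 'I_n) : GPadj n 4 (t, b) (~~ t, b).
Proof. by case: t => /=; rewrite /GPadj /=. Qed.

Definition gpdist (n : nat) (s t : bool) (a b : nat) : nat :=
  cyc n (profile s t) (gap a b).

Lemma gpdist_adj n s (a : 'I_n) (y z : GPvert n) : 24 <= n -> GPadj n 4 y z ->
  near (gpdist n s y.1 a y.2) (gpdist n s z.1 a z.2).
Proof.
move=> n24; case: y z => [t b] [t' c] /=.
have [<-|/negPf tt'] := eqVneq t t'.
  rewrite GPadj_step => /orP[] /eqP h.
    by apply: (step_cyc_near s t n _ a b c erefl n24).
  by rewrite /near andbC; apply: (step_cyc_near s t n _ a c b erefl n24).
have -> : t' = ~~ t by case: (t) (t') tt' => [] [].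
move=> adj; have <- : b = c by move: adj; rewrite /GPadj; case: (t) => /eqP.
have := profile_spoke s (gap a b); have := profile_spoke s (n - gap a b).
by rewrite /gpdist /cyc /near; case: (t) => /=; lia.
Qed.

Lemma gpdist_descent n s (a : 'I_n) (y : GPvert n) : 24 <= n -> y != (s, a) ->
  exists2 z, GPadj n 4 z y & gpdist n s z.1 a z.2 < gpdist n s y.1 a y.2.
Proof.
move=> n24; case: y => [t b] /= ya.
have [an bn] := (ltn_ord a, ltn_ord b).
(* [m] is the complementary offset attaining the minimum, so lowering [profile] at [m] lowers
   [gpdist]. *)
have [m mn hm] : exists2 m, m < n & at_gap n a b m /\ profile s t m = gpdist n s t a b.
  rewrite /gpdist /cyc; case: (leqP (profile s t (gap a b)) (profile s t (n - gap a b))) => h.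
    exists (gap a b); first by rewrite /gap; lia.
    by rewrite /at_gap eqxx; split=> //; lia.
  exists (n - gap a b); last by rewrite /at_gap /gap; lia.
  suff : 0 < gap a b by lia.
  rewrite lt0n; apply: contraL h => /eqP->.
  by rewrite -leqNgt subn0; apply: profile_far; lia.
case: hm => abm <-.
have m0 : (s != t) || (0 < m).
  rewrite orbC lt0n; apply: contraR ya; rewrite negb_or !negbK => /andP[/eqP m0 /eqP<-].
  apply/eqP; congr pair; apply: val_inj => /=; move: abm; rewrite m0 /at_gap /gap; lia.
have viac k c : k = (if t then 4 else 1) -> c < n -> step n k b c -> forall m', m' <= n ->
    at_gap n a c m' -> profile s t m' < profile s t m ->
    exists2 z, GPadj n 4 z (t, b) & gpdist n s z.1 a z.2 < profile s t m.
  move=> kE cn bc m' m'n ac lt; exists (t, Ordinal cn) => /=.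
    by rewrite GPadj_sym GPadj_step -kE.
  rewrite /gpdist (cyc_at_gap _ _ _ _ _ m'n ac).
  by apply: leq_ltn_trans lt; apply: geq_minl.
case: (profile_descent s t m m0)
  => [lt|[t0 [m1 lt]]|[t0 [m1 lt]]|[t1 [[m4 lt]|[m4 lt]]]].
- exists (~~ t, b); first by rewrite GPadj_sym GPadj_spoke.
  rewrite /= /gpdist (cyc_at_gap _ _ _ _ _ (ltnW mn) abm).
  by apply: leq_ltn_trans lt; apply: geq_minl.
- have [c cn [bc ac]] := step_toward n 1 a b m an bn m1 (ltnW mn) abm.
  by apply: (viac 1 c _ cn bc _ _ ac); rewrite ?t0 ?subn1 -?t0 //; lia.
- have [|c cn [bc ac]] := step_away n 1 a b m an bn _ abm; first by lia.
  by apply: (viac 1 c _ cn bc _ _ ac); rewrite ?t0 ?addn1 -?t0 //; lia.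
- have [c cn [bc ac]] := step_toward n 4 a b m an bn m4 (ltnW mn) abm.
  by apply: (viac 4 c _ cn bc _ _ ac) => //; rewrite ?t1 //; lia.
- have [|c cn [bc ac]] := step_across n 4 a b m an bn m4 _ abm; first by lia.
  by apply: (viac 4 c _ cn bc _ _ ac) => //; rewrite ?t1 //; lia.
Qed.

Lemma gdistE n (x y : GPvert n) : 24 <= n ->
  gdist (GPadj n 4) x y = gpdist n x.1 y.1 x.2 y.2.
Proof.
move=> n24; case: x => s a.
pose delta (z : GPvert n) := gpdist n s z.1 a z.2.
apply: (@gdist_potential (GPvert n) (GPadj n 4) (s, a) delta); rewrite /delta.
- by rewrite /gpdist /cyc /gap /= subnn; case: (s); rewrite min0n.
- by move=> z w /(gpdist_adj n s a z w n24) /andP[].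
- by move=> z za; apply: gpdist_descent.
Qed.

(** * Counting W_xy by reflection *)

Lemma Wset_card n (x y : GPvert n) : 24 <= n -> #|Wset (GPadj n 4) x y| =
  \sum_(i < n) (gpdist n false x.1 i x.2 < gpdist n false y.1 i y.2) +
  \sum_(i < n) (gpdist n true x.1 i x.2 < gpdist n true y.1 i y.2).
Proof.
move=> n24; rewrite -sum1_card big_mkcond /=.
pose F (t : bool) (i : 'I_n) : nat := gpdist n t x.1 i x.2 < gpdist n t y.1 i y.2.
rewrite (eq_bigr (fun w => F w.1 w.2)); last first.
  by move=> w _; rewrite inE !gdistE // /F; case: (_ < _).
by rewrite -(pair_bigA _ F) big_bool addnC.
Qed.

Lemma cyc_reflect n h i j : i < n -> j < n ->
  cyc n h (gap ((j + (n - i)) %% n) 0) = cyc n h (gap i j) /\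
  cyc n h (gap ((j + (n - i)) %% n) j) = cyc n h i.
Proof.
move=> i_n jn; rewrite add_mod //; last by lia.
have E o o' : o <= n -> o' = o \/ o' = n - o -> cyc n h o' = cyc n h o.
  by move=> on [->|->] //; rewrite cyc_sub.
by case: ltnP => ?; split; apply: E; rewrite /gap; lia.
Qed.

(* Distances d(u_0,u_i), d(v_0,v_i) and d(u_i,v_j). *)
Definition dU n i := cyc n (profile false false) i.
Definition dV n i := cyc n (profile true true) i.
Definition dC n j i := cyc n (profile false true) (gap i j).

(* Contributions of the pair {u_i, v_(j-i)} to |W_xy| and |W_yx|, for x = u_0, y = v_j. *)
Definition lead n j i : nat := (dU n i < dC n j i) + (dC n j i < dV n i).
Definition lag n j i : nat := (dC n j i < dU n i) + (dV n i < dC n j i).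

Section Reflection.
Variables (n : nat) (j : 'I_n).

Let reflect_lt (i : 'I_n) : (j + (n - i)) %% n < n.
Proof. by rewrite ltn_mod; case: (n) i => // -[]. Qed.

Definition reflect_ord (i : 'I_n) : 'I_n := Ordinal (reflect_lt i).

Lemma reflect_ordK : involutive reflect_ord.
Proof.
move=> i; apply: val_inj => /=; have [hi hj] := (ltn_ord i, ltn_ord j).
rewrite (add_mod n j (n - i)) //; last by lia.
by case: ltnP => ?; rewrite add_mod //; try lia; case: ltnP; lia.
Qed.

End Reflection.

(** Reindexing the sum over inner vertices by [reflect_ord] turns the distance to u_0 into
    [dC n j i] and the distance to v_j into [dV n i]. *)
Lemma Wset_spoke n (o j : 'I_n) : 24 <= n -> o = 0 :> nat ->
  #|Wset (GPadj n 4) (false, o) (true, j)| = \sum_(i < n) lead n j i /\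
  #|Wset (GPadj n 4) (true, j) (false, o)| = \sum_(i < n) lag n j i.
Proof.
move=> n24 o0; rewrite !Wset_card //= /lead /lag !big_split /=.
split; congr (_ + _).
- by apply: eq_bigr => i _; rewrite /gpdist o0 /gap subn0 sub0n addn0.
- rewrite (reindex_inj (inv_inj (reflect_ordK n j))); apply: eq_bigr => i _ /=.
  have [e1 _] := cyc_reflect n (profile true false) i j (ltn_ord i) (ltn_ord j).
  have [_ e2] := cyc_reflect n (profile true true) i j (ltn_ord i) (ltn_ord j).
  by rewrite /gpdist o0 e1 e2.
- by apply: eq_bigr => i _; rewrite /gpdist o0 /gap subn0 sub0n addn0.
- rewrite (reindex_inj (inv_inj (reflect_ordK n j))); apply: eq_bigr => i _ /=.
  have [e1 _] := cyc_reflect n (profile true false) i j (ltn_ord i) (ltn_ord j).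
  have [_ e2] := cyc_reflect n (profile true true) i j (ltn_ord i) (ltn_ord j).
  by rewrite /gpdist o0 e1 e2.
Qed.

Lemma unbalanced n j : 24 <= n -> j < n ->
  \sum_(i < n) lead n j i <> \sum_(i < n) lag n j i ->
  ~ dist_balanced (GPadj n 4) (cyc n rad j + 1).
Proof.
move=> n24 jn neq bal; apply: neq.
have n0 : 0 < n by lia.
have [<- <-] := Wset_spoke n (Ordinal n0) (Ordinal jn) n24 erefl.
apply: bal; rewrite gdistE //= /gpdist /= /cyc /gap /= sub0n subn0 add0n /profile.
by rewrite addn_minl.
Qed.

(** * Realizing every length below the diameter *)

Lemma cyc_rad_step n o : o < n -> near (cyc n rad o) (cyc n rad o.+1).
Proof.
move=> on; rewrite -addn1; apply: near_cyc_add; last by lia.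
by move=> m; rewrite /near /rad; lia.
Qed.

Lemma gpdist_le n s t a b : gpdist n s t a b <= cyc n rad (gap a b) + 2.
Proof.
have le m : profile s t m <= rad m + 2.
  by case: s; case: t; rewrite /profile /rad; lia.
by move: (le (gap a b)) (le (n - gap a b)); rewrite /gpdist /cyc; lia.
Qed.

Lemma cyc_rad_onto n l : 24 <= n -> 0 < l -> l < gdiam (GPadj n 4) ->
  exists2 j, j < n & cyc n rad j + 1 = l /\ rad j <= rad (n - j).
Proof.
move=> n24 l0 ldiam.
have [o on lo] : exists2 o, o < n & l <= cyc n rad o + 1.
  (* Since [l < gdiam], some distance is at least [l + 1]; it is at most f + 2, whence
     [l <= f + 1]. *)
  case: (boolP [exists x, [exists y, l < gdist (GPadj n 4) x y]]).
    case/existsP=> x /existsP[y]; rewrite gdistE // => h.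
    exists (gap x.2 y.2); first by rewrite /gap; have := ltn_ord x.2; have := ltn_ord y.2; lia.
    by rewrite -ltnS -addnS; exact: leq_trans h (gpdist_le _ _ _ _ _).
  move=> none; move: ldiam; rewrite ltnNge; case/negP.
  apply/bigmax_leqP => x _; apply/bigmax_leqP => y _; rewrite leqNgt.
  by apply: contra none => h; apply/existsP; exists x; apply/existsP; exists y.
have ex : exists j, (j < n) && (l <= cyc n rad j + 1) by exists o; rewrite on.
(* By the Lipschitz property the least j with l <= f(j) + 1 attains equality. *)
case: (ex_minnP ex) => j /andP[jn lj] minj.
have fj : cyc n rad j + 1 = l.
  case: j jn lj minj => [|j] jn lj minj; first by move: lj; rewrite /cyc min0n; lia.
  have := cyc_rad_step n j (ltnW jn); rewrite /near.
  case: (leqP l (cyc n rad j + 1)) => h; last by lia.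
  by have := minj j; rewrite h (ltnW jn) ltnn; move/(_ isT).
(* By symmetry of [cyc], [j] may be swapped with [n - j]. *)
case: (leqP (rad j) (rad (n - j))) => h; first by exists j.
exists (n - j); last by rewrite cyc_sub ?subKn; [split=> //; exact: ltnW | exact: ltnW..].
by case: j h {jn lj minj fj} => [|j]; rewrite ?subn0 //; lia.
Qed.

(** * Pairwise comparison and the case f(j) >= 6 *)

Lemma lead_le_lag n j i : 4 <= i -> i + 4 <= n -> lead n j i <= lag n j i.
Proof.
move=> i4 in4; rewrite /lead /lag.
suff : dV n i <= dU n i by lia.
rewrite /dU /dV /cyc.
have h m : 4 <= m -> profile true true m <= profile false false m.
  by rewrite /profile /rad; lia.
by have := h i i4; have := h (n - i); lia.
Qed.

Lemma lead_le_lag_far n j i : 24 <= n -> i < n -> j < n -> 6 <= cyc n rad j ->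
  lead n j i <= lag n j i.
Proof.
move=> n24 i_n jn fj.
case: (boolP ((4 <= i) && (i + 4 <= n))) => [/andP[? ?]|iout].
  by apply: lead_le_lag => //; lia.
(* Moving by at most 3 costs at most 2, so f(j) >= 6 leaves at least 4 near the base. *)
have rad_shift m d : d <= 3 -> rad m <= rad (m + d) + 2 /\ rad (m + d) <= rad m + 2.
  by rewrite /rad; lia.
have [i0|i0] := posnP i.
  have C0 : 0 < dC n j 0 by rewrite /dC /cyc /profile; lia.
  by rewrite i0 /lead /lag /dU /dV /cyc /= !min0n; lia.
(* Here dU and dV are at most 4 while dC is at least 5. *)
have [M [UM VM MC]] : exists M, [/\ dU n i <= M, dV n i <= M & M < dC n j i].
  exists 4.
  have small m : m <= 3 -> profile false false m <= 4 /\ profile true true m <= 4.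
    by move: m => [|[|[|[|m]]]].
  have [hi hni] := (small i, small (n - i)).
  split; [by rewrite /dU /cyc; lia | by rewrite /dV /cyc; lia |].
  have : 4 <= cyc n rad (gap i j); last by rewrite /dC /cyc /profile; lia.
  have j16 : 16 <= j by move: fj; rewrite /cyc /rad; lia.
  have nj16 : 16 <= n - j by move: fj; rewrite /cyc /rad; lia.
  have [i3|i3] : i <= 3 \/ n - i <= 3 by lia.
    have -> : gap i j = j - i by rewrite /gap; lia.
    have := rad_shift (j - i) i i3; have := rad_shift (n - j) i i3.
    have -> : n - j + i = n - (j - i) by lia.
    by rewrite subnK; last lia; move: fj; rewrite /cyc; lia.
  have -> : gap i j = n - j - (n - i) by rewrite /gap; lia.
  have := rad_shift (n - j - (n - i)) (n - i) i3; have := rad_shift j (n - i) i3.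
  have -> : j + (n - i) = n - (n - j - (n - i)) by lia.
  by rewrite subnK; last lia; move: fj; rewrite /cyc; lia.
by rewrite /lead /lag; lia.
Qed.

(** Here [dC] is q + 1 or q + 2, hence above [dV <= q] but not above [dU >= q + 2]: the lead is 0
    and the lag positive. *)
Lemma lead_lt_lag n j q i : 24 <= n -> j < n -> 6 <= rad j -> rad j <= rad (n - j) ->
  q = rad j %/ 2 -> i = 4 * q -> i < n /\ lead n j i < lag n j i.
Proof.
move=> n24 jn j6 jnj qE iE.
have [a [r [jE r4]]] : exists a r, j = 4 * a + r /\ r < 4.
  by exists (j %/ 4), (j %% 4); lia.
have kE : rad j = a + minn r 2 by rewrite /rad; lia.
have qa : q <= a by lia.
have radnj : n - j <= 4 * rad (n - j) + 1 /\ 4 * rad (n - j) <= n - j + 6 by rewrite /rad; lia.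
have i_n : i < n by lia.
have radD m p : rad (m + 4 * p) = rad m + p by rewrite /rad; lia.
have Ci : dC n j i = rad j - q + 1.
  have radji : rad j = rad (j - i) + q by rewrite -radD; congr rad; lia.
  have : rad (n - (j - i)) = rad (n - j) + q by rewrite -radD; congr rad; lia.
  have -> : dC n j i = minn (rad (j - i)) (rad (n - (j - i))) + 1.
    by rewrite /dC /cyc /profile; have -> : gap i j = j - i; [rewrite /gap|]; lia.
  lia.
have Vi : dV n i <= q.
  rewrite /dV /cyc geq_min; apply/orP; left.
  have [idiv imod] : i %/ 4 = q /\ i %% 4 = 0 by rewrite iE mulKn // modnMr.
  by rewrite /profile /rad idiv imod; lia.
have Ui : q + 2 <= dU n i.
  have radi : rad i = q by rewrite iE -[4 * q]add0n radD.
  have : q <= rad (n - i).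
    have -> : n - i = n - j + r + 4 * (a - q) by lia.
    (* The bound 2 suffices because [2 * q <= rad j <= a + 2]. *)
    have : 2 <= rad (n - j + r) by rewrite {1}/rad; lia.
    by rewrite radD; lia.
  by rewrite /dU /cyc /profile radi; lia.
by rewrite /lead /lag Ci; lia.
Qed.

Lemma ltn_sum_ord n (a b : nat -> nat) i0 : i0 < n -> a i0 < b i0 ->
  (forall i, i < n -> a i <= b i) -> \sum_(i < n) a i < \sum_(i < n) b i.
Proof.
move=> i0n lt le; rewrite (bigD1 (Ordinal i0n)) //= [ltnRHS](bigD1 (Ordinal i0n)) //=.
rewrite -addSn leq_add //.
by apply: leq_sum => i _; apply: le.
Qed.

(** * The case f(j) <= 5 and n >= 84 *)

Lemma sumn_iota (F : nat -> nat) m n :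
  \sum_(m <= i < m + n) F i = sumn [seq F i | i <- iota m n].
Proof. by rewrite sumnE big_map /index_iota addKn. Qed.

(* The contributions of an index at distance d from 0 and s from j, once n is large. *)
Definition end_lead d s : nat :=
  (profile false false d < rad s + 1) + (rad s + 1 < profile true true d).
Definition end_lag d s : nat :=
  (rad s + 1 < profile false false d) + (profile true true d < rad s + 1).

(** The window below has offsets up to 20 + 14 = 34, with profile at most 12; their complements are
    at least 50, with profile at least 13. *)
Lemma cyc_profile_short n s t o : o <= 34 -> 84 <= n ->
  cyc n (profile s t) o = profile s t o.
Proof. by move=> o34 n84; apply: cyc_short; case: s; case: t; rewrite /profile /rad; lia. Qed.

(** The sum over the 41 residues within 20 of 0: first the indices [d], then the indices [n - d]. *)
Definition window (w : nat -> nat -> nat) (j : nat) : nat :=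
  sumn [seq w d (gap d j) | d <- iota 0 21] + sumn [seq w d (d + j) | d <- iota 1 20].

Lemma lead_lt_lag_window n j : 84 <= n -> j <= 14 ->
  window end_lead j < window end_lag j -> \sum_(i < n) lead n j i < \sum_(i < n) lag n j i.
Proof.
move=> n84 j14 win.
have split3 (F : nat -> nat) : \sum_(i < n) F i =
    \sum_(0 <= i < 0 + 21) F i + \sum_(1 <= d < 1 + 20) F (n - d) +
    \sum_(21 <= i < n - 20) F i.
  rewrite -(big_mkord xpredT) (@big_cat_nat _ _ _ 21) //=; last by lia.
  rewrite (@big_cat_nat _ _ _ (n - 20) 21 n) /=; [|lia..].
  rewrite -addnA [X in _ + X]addnC; congr (_ + (_ + _)).
  rewrite -[n - 20]addn0 addnC big_addn.
  have -> : n - (n - 20) = 20 by lia.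
  rewrite big_add1 /= big_nat_rev /=; apply: eq_big_nat => i ?; congr F; lia.
have near_eq d : d < 21 ->
    lead n j d = end_lead d (gap d j) /\ lag n j d = end_lag d (gap d j).
  move=> d21; rewrite /lead /lag /dU /dV /dC !cyc_profile_short //; try lia.
  by rewrite /gap; lia.
have far_eq d : 0 < d -> d <= 20 ->
    lead n j (n - d) = end_lead d (d + j) /\ lag n j (n - d) = end_lag d (d + j).
  move=> d0 d20; rewrite /lead /lag /dU /dV /dC.
  have -> : gap (n - d) j = n - (d + j) by rewrite /gap; lia.
  by rewrite !cyc_sub ?cyc_profile_short //; lia.
rewrite !split3 -addSn leq_add //; last first.
  rewrite !big_nat; apply: leq_sum => i /andP[i21 ni].
  by apply: lead_le_lag; lia.
move: win; rewrite /window -!sumn_iota.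
move=> win; apply: leq_ltn_trans (leq_trans win _).
  apply: eq_leq; congr (_ + _); apply: eq_big_nat => i /andP[i1 i2].
    by case: (near_eq i i2).
  by case: (far_eq i i1 i2).
apply: eq_leq; congr (_ + _); symmetry; apply: eq_big_nat => i /andP[i1 i2].
  by case: (near_eq i i2).
by case: (far_eq i i1 i2).
Qed.

(** * Finite checks *)

(* Conditionals rather than [&&] or [==>], whose second argument vm_compute would
   always evaluate. *)
Definition witness (n k j : nat) : bool :=
  if cyc n rad j == k
  then sumn [seq lead n j i | i <- iota 0 n] != sumn [seq lag n j i | i <- iota 0 n]
  else false.

(** The second alternative covers values that f never takes, such as 5 for [n = 25]. *)
Lemma witness_small n k : 25 <= n -> n < 84 -> k < 6 ->
  has (witness n k) (iota 0 n) || all (fun j => cyc n rad j != k) (iota 0 n).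
Proof.
move=> n25 n84 k6.
have : all (fun n => all (fun k => has (witness n k) (iota 0 n)
    || all (fun j => cyc n rad j != k) (iota 0 n)) (iota 0 6)) (iota 25 59).
  by vm_compute.
by move/allP/(_ n); rewrite mem_iota => /(_ _)/allP; apply; rewrite ?mem_iota; lia.
Qed.

(** [#|Wset|] as sums over lists of numbers, suited to [vm_compute]. *)
Definition closer (n : nat) (s t : bool) (a b : nat) : nat :=
  sumn [seq nat_of_bool (gpdist n false s i a < gpdist n false t i b) | i <- iota 0 n] +
  sumn [seq nat_of_bool (gpdist n true s i a < gpdist n true t i b) | i <- iota 0 n].

Lemma Wset_closer n (x y : GPvert n) : 24 <= n ->
  #|Wset (GPadj n 4) x y| = closer n x.1 y.1 x.2 y.2.
Proof. by move=> n24; rewrite Wset_card // /closer -!sumn_iota !big_mkord. Qed.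

Definition fair (n l : nat) (s t : bool) (a b : nat) : bool :=
  if gpdist n s t a b == l then closer n s t a b == closer n t s b a else true.

Lemma GP24_balanced : dist_balanced (GPadj 24 4) 1.
Proof.
move=> x y; rewrite (gdistE 24 x y isT) !(Wset_closer 24 _ _ isT) => dxy.
suff : fair 24 1 x.1 y.1 x.2 y.2 by rewrite /fair dxy => /eqP.
have /allP/(_ (x.2 : nat)) : all (fun a => all (fun b => all (fun s => all (fun t =>
    fair 24 1 s t a b) [:: false; true]) [:: false; true]) (iota 0 24)) (iota 0 24).
  by vm_compute.
rewrite mem_iota ltn_ord => /(_ isT)/allP/(_ (y.2 : nat)).
rewrite mem_iota ltn_ord => /(_ isT)/allP/(_ x.1).
have inb (b : bool) : b \in [:: false; true] by case: b.
by rewrite inb => /(_ isT)/allP/(_ y.1); rewrite inb; apply.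
Qed.

Theorem theorem1p4 :
  GP4_property 24 /\ (forall N : nat, N < 24 -> ~ GP4_property N).
Proof.
split=> [n n24 _ l l0 ldiam | N N24 /(_ 24 N24 isT 1 isT)]; last first.
  move/(_ _ GP24_balanced); apply.
  (* u_0 and v_1 are at distance 2, so 1 is below the diameter. *)
  pose x : GPvert 24 := (false, ord0); pose y : GPvert 24 := (true, inord 1).
  apply: leq_trans (leq_bigmax x); apply: leq_trans (leq_bigmax y).
  by rewrite gdistE // /x /y /= inordK.
have [j jn [<- radj]] := cyc_rad_onto n l (ltnW n24) l0 ldiam.
have cycj : cyc n rad j = rad j by apply: cyc_short.
have sumE (F : nat -> nat) : \sum_(i < n) F i = sumn [seq F i | i <- iota 0 n].
  by rewrite -sumn_iota big_mkord.
case: (leqP 6 (rad j)) => j6.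
  apply: unbalanced => //; first exact: ltnW.
  have [i_n lt] := lead_lt_lag n j _ _ (ltnW n24) jn j6 radj erefl erefl.
  apply/eqP; rewrite neq_ltn; apply/orP; left; apply: (ltn_sum_ord _ _ _ _ i_n lt) => i ?.
  by apply: lead_le_lag_far; rewrite ?cycj //; lia.
case: (ltnP n 84) => n84.
  case/orP: (witness_small n (rad j) n24 n84 j6) => [/hasP[i]|/allP/(_ j)]; last first.
    by rewrite mem_iota jn cycj eqxx => /(_ isT).
  rewrite mem_iota /witness => /andP[_ i_n]; case: eqP => // fi neq; rewrite cycj -fi.
  by apply: unbalanced; [exact: ltnW | | rewrite !sumE; apply/eqP].
have [m [m14 mE win]] : exists m,
    [/\ m <= 14, rad m = rad j & window end_lead m < window end_lag m].
  (* The entry at position k has [rad] equal to k; it may replace [j], since [l] depends only on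
     f(j). *)
  exists (nth 0 [:: 0; 1; 3; 6; 10; 14] (rad j)).
  by move: (rad j) j6 => [|[|[|[|[|[|k]]]]]] //; split; vm_compute.
have cycm : cyc n rad m = rad j by rewrite -mE; apply: cyc_short; rewrite /rad; lia.
rewrite cycj -cycm; apply: unbalanced; [lia|lia|].
by apply/eqP; rewrite neq_ltn lead_lt_lag_window.
Qed.
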